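(* Let $\lambda$ be an eigenvalue with elementary divisor of multiplicity $m\ge2$ of the matrix $B$ corresponding to the real eigenvector $\nu^0$ and to the real generalized eigenvectors $\nu^k$ of order $k$, $k=1,\ldots,m-1$. Then the system $\dfrac{dx}{dt}=Ax$ has the first integrals $$F_g\colon x\to\Psi_g(x)\quad\text{for all }x\in\mathscr X,\quad g=2,\ldots,m-1,$$ where the functions $\Psi_g\colon\mathscr X\to\mathbb R$ are the solution of the system $$\nu^kx=\sum_{i=1}^k\binom{k-1}{i-1}\Psi_i(x)\,\nu^{k-i}x,\quad k=1,\ldots,m-1,$$ and $\mathscr X\subset\{x\colon\nu^0x\ne0\}$ is a domain.
   Context: $A$ is a real $n\times n$ matrix, $x\in\mathbb R^n$, and $B=A^T$. For a vector $\nu$, $\nu x=\sum_{i=1}^n\nu_ix_i$. If $\nu^0$ is an eigenvector of $B$ for the eigenvalue $\lambda$ with elementary divisor of multiplicity $m$, a nonzero vector $\nu^k$ is a generalized eigenvector of order $k$ for $\lambda$ if $(B-\lambda E)\nu^k=k\,\nu^{k-1}$, $k=1,\ldots,m-1$ ($E$ the identity matrix). A continuously differentiable function $F$ on a domain $\mathscr X\subset\mathbb R^n$ is an autonomous first integral of $dx/dt=Ax$ if $\sum_{i=1}^n(Ax)_i\,\partial_{x_i}F(x)=0$ on $\mathscr X$. *)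

(* Defs.v *)
From HB Require Import structures.
From mathcomp Require Import all_boot all_order all_algebra.
From mathcomp Require Import all_classical all_reals all_analysis.
Import Order.TTheory GRing.Theory Num.Theory.
Import numFieldNormedType.Exports.

Set Implicit Arguments.
Unset Strict Implicit.
Unset Printing Implicit Defensive.

Local Open Scope classical_set_scope.
Local Open Scope ring_scope.

(* Gcd of the k x k minors of the characteristic matrix 'X - B.  Non-monotone
   (f, g) only repeat minors up to sign and non-injective ones give 0, so they
   do not affect the gcd; gcdp is defined only up to a nonzero constant. *)
Definition determinantal_divisor (F : fieldType) (n : nat) (B : 'M[F]_n)
    (k : nat) : {poly F} :=
  \big[@gcdp F/0]_(f : {ffun 'I_k -> 'I_n})
    \big[@gcdp F/0]_(g : {ffun 'I_k -> 'I_n})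
      \det (mxsub f g (char_poly_mx B)).

(* The invariant factor of 'X - B of index k + 1, for k < n. *)
Definition invariant_factor (F : fieldType) (n : nat) (B : 'M[F]_n)
    (k : nat) : {poly F} :=
  determinantal_divisor B k.+1 %/ determinantal_divisor B k.

(* ('X - lambda)^m, with m > 0, is an elementary divisor of B. *)
Definition has_elementary_divisor (F : fieldType) (n : nat) (B : 'M[F]_n)
    (lambda : F) (m : nat) : Prop :=
  (0 < m)%N /\ exists k : 'I_n, mup lambda (invariant_factor B k) = m.

Definition is_eigenvector (F : fieldType) (n : nat) (B : 'M[F]_n)
    (lambda : F) (nu : 'cV[F]_n) : Prop :=
  nu != 0 /\ B *m nu = lambda *: nu.

(* Only the entries nu 0, ..., nu k of the sequence nu are relevant. *)
Definition is_generalized_eigenvector (F : fieldType) (n : nat) (B : 'M[F]_n)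
    (lambda : F) (nu : nat -> 'cV[F]_n) (k : nat) : Prop :=
  nu k != 0 /\ (B - lambda%:M) *m nu k = k%:R *: nu k.-1.

Definition pairing (F : fieldType) (n : nat) (nu x : 'cV[F]_n) : F :=
  \sum_(i < n) nu i 0 * x i 0.

Definition is_domain (T : topologicalType) (X : set T) : Prop :=
  [/\ open X, connected X & X !=set0].

Section FirstIntegral.
Variables (R : realType) (n : nat).

Definition partial (F : 'cV[R]_n -> R) (i : 'I_n) (x : 'cV[R]_n) : R :=
  'D_(delta_mx i 0) F x.

(* Meant for open X: only the values of F on X then matter. *)
Definition continuously_differentiable_on (X : set 'cV[R]_n)
    (F : 'cV[R]_n -> R) : Prop :=
  forall x, X x ->
    differentiable F x /\ forall i, {for x, continuous (partial F i)}.

Definition is_first_integral (A : 'M[R]_n) (X : set 'cV[R]_n)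
    (F : 'cV[R]_n -> R) : Prop :=
  continuously_differentiable_on X F /\
  forall x, X x -> \sum_(i < n) (A *m x) i 0 * partial F i x = 0.

(* Psi i is relevant only for 1 <= i <= m - 1. *)
Definition solves_psi_system (nu : nat -> 'cV[R]_n) (m : nat)
    (X : set 'cV[R]_n) (Psi : nat -> 'cV[R]_n -> R) : Prop :=
  forall k, (1 <= k <= m - 1)%N -> forall x, X x ->
    pairing (nu k) x =
    \sum_(1 <= i < k.+1)
      'C(k - 1, i - 1)%:R * Psi i x * pairing (nu (k - i)%N) x.

End FirstIntegral.

(* Main.v *)
Require Import Defs.
From mathcomp Require Import all_boot all_order all_algebra.
From mathcomp Require Import all_classical all_reals all_analysis.
Import Order.TTheory GRing.Theory Num.Theory.
From mathcomp Require Import ring.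
Import numFieldNormedType.Exports.
Local Open Scope classical_set_scope.
Local Open Scope ring_scope.

(** Write [p_k] for the linear form [x |-> nu^k x] and [D] for the derivative
    along the vector field [x |-> A x].  Since [B = A^T], the chain relations
    for the [nu^k] become [D p_k = lambda p_k + k p_{k-1}].  In terms of the
    exponential generating function [P(t) = \sum_k p_k t^k / k!] this says
    [D P = (lambda + t) P].

    With [S(t) = \sum_{i >= 1} Psi_i t^i / i!], the system defining the [Psi_i]
    is the coefficientwise form of [P' = S' P], that is, [S = log (P / p_0)].
    Hence [D S = D P / P - D p_0 / p_0 = t]: [D Psi_1 = 1], and [D Psi_i = 0]
    for [i >= 2], which is the assertion.

    The formal proof works with the coefficients.  The system is triangular
    with diagonal entry
    [p_0], nonzero on [X]; this gives existence and uniqueness pointwise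
    ([convolution_system_exists], [convolution_system_unique]), and it shows by
    induction that every [Psi_i] agrees on [X] with a rational function with
    denominator a power of [p_0].  Being continuously differentiable on an open
    set is stable under the operations involved, and depends only on the values
    there ([cdiff_eq]), so any solution is continuously differentiable.  The
    computation of [D Psi_i] is carried out pointwise, on sequences of scalars,
    in [log_derivation]. *)

(** * The triangular system and its logarithmic derivative *)

(** The [j]-th coefficient of the product of two exponential generating
    functions.  With [q_i = Psi_{i+1}], the coefficients of [S'], the equation
    of index [j + 1] of the system reads
    [p_{j+1} = binomial_convolution q p j]. *)
Definition binomial_convolution {F : fieldType} (q p : nat -> F) (j : nat) : F :=
  \sum_(i < j.+1) 'C(j, i)%:R * q i * p (j - i)%N.

Lemma binomial_convolution_recr {F : fieldType} (q p : nat -> F) j :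
  binomial_convolution q p j =
  \sum_(i < j) 'C(j, i)%:R * q i * p (j - i)%N + q j * p 0%N.
Proof. by rewrite /binomial_convolution big_ord_recr /= binn subnn mul1r. Qed.

(** Only [q_j] is new in the [j]-th equation, and its coefficient is [p_0]; so
    the solution is extended one entry at a time. *)
Lemma convolution_system_exists {F : fieldType} (p : nat -> F) (M : nat) :
  p 0%N != 0 ->
  exists q, forall j, (j < M)%N -> p j.+1 = binomial_convolution q p j.
Proof.
move=> p0; elim: M => [|M [q hq]]; first by exists (fun=> 0).
pose r := (p M.+1 - \sum_(i < M) 'C(M, i)%:R * q i * p (M - i)%N) / p 0%N.
exists (fun i => if (i < M)%N then q i else r) => j.
rewrite ltnS leq_eqVlt => /orP[/eqP->|jM]; rewrite binomial_convolution_recr.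
  rewrite ltnn divfK //; under eq_bigr do rewrite ltn_ord.
  by rewrite addrC subrK.
rewrite jM hq // binomial_convolution_recr; congr (_ + _).
by apply: eq_bigr => i _; rewrite (ltn_trans (ltn_ord i) jM).
Qed.

Lemma convolution_system_unique {F : fieldType} (p q q' : nat -> F) (M : nat) :
  p 0%N != 0 ->
  (forall j, (j < M)%N -> p j.+1 = binomial_convolution q p j) ->
  (forall j, (j < M)%N -> p j.+1 = binomial_convolution q' p j) ->
  forall j, (j < M)%N -> q j = q' j.
Proof.
move=> p0 hq hq'; elim/ltn_ind => j IH jM.
have := hq' j jM; rewrite hq // !binomial_convolution_recr.
rewrite (eq_bigr (fun i : 'I_j => 'C(j, i)%:R * q' i * p (j - i)%N)) => [|i _].
  by move=> /addrI /(mulIf p0).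
by rewrite IH // (ltn_trans (ltn_ord i)).
Qed.

(** The sequences [dp] and [dq] stand for the values at a point of a derivation
    on [p] and [q], the last hypothesis being the Leibniz rule applied to
    [p_{j+1}].  With generating functions [P' = Q P] and [D P = (lambda + t) P],
    comparing [D (P')] with [(D P)'] yields [(D Q) P = P], whence [D Q = 1]. *)
Lemma log_derivation {F : fieldType} (lambda : F) (p dp q dq : nat -> F)
    (M : nat) :
  p 0%N != 0 ->
  (forall k, (k <= M)%N -> dp k = lambda * p k + k%:R * p k.-1) ->
  (forall j, (j < M)%N -> p j.+1 = binomial_convolution q p j) ->
  (forall j, (j < M)%N -> dp j.+1 =
     binomial_convolution dq p j + binomial_convolution q dp j) ->
  forall j, (j < M)%N -> dq j = (j == 0%N)%:R.
Proof.
move=> p0 hdp hp hdq.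
(* This is [(D Q) P = P]: what remains once [Q (D P) = lambda P' + t P'] is
   subtracted from [D (P') = (lambda + t) P' + P]. *)
have dqp j : (j < M)%N -> binomial_convolution dq p j = p j.
  move=> jM; have := hdq j jM; rewrite hdp // => E.
  suff H : binomial_convolution q dp j = lambda * p j.+1 + j%:R * p j.
    apply: (addIr (binomial_convolution q dp j)).
    by rewrite -E H mulrS /=; ring.
  rewrite hp // mulr_sumr.
  (* The coefficient of [t P' = Q (t P)]. *)
  have -> : j%:R * p j = \sum_(i < j.+1)
      'C(j, i)%:R * q i * ((j - i)%:R * p (j - i).-1).
    rewrite big_ord_recr /= subnn mul0r mulr0 addr0.
    case: j jM {hp E} (hp j.-1) => [|j] jM hp; first by rewrite big_ord0 mul0r.
    rewrite /= (hp (ltnW jM)) mulr_sumr; apply: eq_bigr => i _.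
    have ij : (i <= j)%N by rewrite -ltnS.
    rewrite subSn //= -subSn //.
    have /(congr1 (fun n => n%:R : F)) := mul_bin_down j.+1 i.
    by rewrite !natrM /= !mulrA => ->; ring.
  rewrite -big_split; apply: eq_bigr => i _ /=.
  by rewrite hdp ?(leq_trans (leq_subr _ _)) 1?ltnW //; ring.
(* In [(D Q) P = P] the term [dq_0 p_j = p_j] already accounts for the right
   hand side when [0 < j], so that [dq_j p_0] vanishes. *)
elim/ltn_ind => -[|j] IH jM; apply: (mulIf p0); have := dqp _ jM;
  rewrite binomial_convolution_recr.
  by rewrite big_ord0 add0r mul1r.
rewrite big_ord_recl /= (IH 0%N) ?(ltn_trans _ jM) // big1 => [|i _].
  rewrite bin0 subn0 !mul1r addr0 mul0r => /eqP.
  by rewrite -subr_eq0 addrC addKr => /eqP.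
by rewrite /bump add1n IH ?mulr0 ?mul0r // ?(ltn_trans _ jM) // ltnS.
Qed.

(** * Continuously differentiable functions on an open set *)

(** The differential of [f] at [x] still approximates [g] to first order, since
    the remainder is only tested near [x]; uniqueness of the differential then
    identifies it as that of [g]. *)
Lemma near_eq_differentiable (R : numFieldType) (V W : normedModType R)
    (f g : V -> W) (x : V) :
  {near x, f =1 g} -> differentiable f x -> differentiable g x.
Proof.
move=> fg /diff_locallyP[dfc dfE].
have fgx : f x = g x by exact: nbhs_singleton fg.
have E : g \o shift x = cst (g x) + 'd f x +o_ 0 id.
  apply/eqaddoP => e e0; have /eqaddoP/(_ e e0) := dfE.
  apply: filter_app.
  have : \forall h \near (0 : V), f (h + x) = g (h + x).
    move: fg; rewrite (near_shift 0) /=.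
    by apply: filterS => h /=; rewrite subr0.
  by apply: filterS => h /= fgh; rewrite !fctE /= fgh fgx.
by apply/diff_locallyP; rewrite (diff_unique dfc E).
Qed.

Section ContinuouslyDifferentiable.
Context {R : realType} {n : nat}.
Implicit Types (F G : 'cV[R]_n -> R) (X : set 'cV[R]_n) (u v x : 'cV[R]_n).

Lemma pairing_differentiable u x : differentiable (pairing u) x.
Proof.
have -> : pairing u = \sum_(i < n) u i 0 *: (fun y : 'cV[R]_n => y i 0 : R).
  by apply/funext => y; rewrite fct_sumE.
apply: differentiable_sum => i; apply: differentiableZ.
exact: differentiable_coord.
Qed.

Lemma derive_pairing u v x : 'D_v (pairing u) x = pairing u v.
Proof.
rewrite /derive; apply: cvg_lim => //; apply: cvg_near_cst.
rewrite near_withinE; near=> h => h0 /=.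
rewrite -[LHS]/(h^-1 * (pairing u (h *: v + x) - pairing u x)).
rewrite /pairing -sumrB mulr_sumr; apply: eq_bigr => i _.
by rewrite !mxE; field.
Unshelve. all: by end_near. Qed.

(** The condition defining first integrals is thus that the derivative along
    [A *m x] vanishes, to which the usual rules of derivation apply. *)
Lemma derive_partial F v x : differentiable F x ->
  \sum_(i < n) v i 0 * partial F i x = 'D_v F x.
Proof.
move=> dF; rewrite deriveE // [in RHS](matrix_sum_delta v).
under [in RHS]eq_bigr do rewrite big_ord1.
rewrite linear_sum; apply: eq_bigr => i _.
by rewrite linearZ /= /partial deriveE.
Qed.

Lemma cdiff_pairing X u : continuously_differentiable_on X (pairing u).
Proof.
move=> x _; split=> [|i]; first exact: pairing_differentiable.
rewrite (_ : partial _ _ = cst (pairing u (delta_mx i 0))).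
  exact: cst_continuous.
by apply/funext => y; rewrite /partial derive_pairing.
Qed.

Lemma cdiff_cst X (c : R) : continuously_differentiable_on X (cst c).
Proof.
move=> x _; split=> [|i]; first exact: differentiable_cst.
rewrite (_ : partial _ _ = cst 0); first exact: cst_continuous.
by apply/funext => y; rewrite /partial derive_cst.
Qed.

Lemma open_eq_continuous X F G x :
  open X -> X x -> (forall y, X y -> F y = G y) ->
  {for x, continuous F} -> {for x, continuous G}.
Proof.
move=> oX Xx FG cF; rewrite /prop_for /continuous_at -FG //.
have nFG : {near x, F =1 G}.
  by have : nbhs x X by [exact: open_nbhs_nbhs]; apply: filterS.
by apply: cvg_trans cF; apply (near_eq_cvg nFG).
Qed.

(** The system constrains its solutions on [X] only; this transfers regularity
    to them from rational functions that make sense everywhere. *)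
Lemma cdiff_eq X F G : open X -> (forall y, X y -> F y = G y) ->
  continuously_differentiable_on X F -> continuously_differentiable_on X G.
Proof.
move=> oX FG cF x Xx; have [dF pF] := cF x Xx.
have nFG y : X y -> {near y, F =1 G}.
  by move=> Xy; have : nbhs y X by [exact: open_nbhs_nbhs]; apply: filterS.
split=> [|i]; first exact: near_eq_differentiable (nFG x Xx) dF.
apply: (@open_eq_continuous X (partial F i)) => // y Xy.
apply: near_eq_derive; exact: nFG.
Qed.

Lemma cdiffB X F G : open X -> continuously_differentiable_on X F ->
  continuously_differentiable_on X G ->
  continuously_differentiable_on X (F - G).
Proof.
move=> oX cF cG x Xx; have [dF pF] := cF x Xx; have [dG pG] := cG x Xx.
split=> [|i]; first exact: differentiableB.
apply: (@open_eq_continuous X (fun y => partial F i y - partial G i y)) => //.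
  2: exact: continuousB.
move=> y Xy; have [? _] := cF y Xy; have [? _] := cG y Xy.
by rewrite /partial deriveB //; exact: diff_derivable.
Qed.

Lemma cdiffD X F G : open X -> continuously_differentiable_on X F ->
  continuously_differentiable_on X G ->
  continuously_differentiable_on X (F + G).
Proof.
move=> oX cF cG; rewrite -[G]opprK -[- G]add0r; apply: cdiffB => //.
by apply: cdiffB => //; exact: cdiff_cst.
Qed.

Lemma cdiffM X F G : open X -> continuously_differentiable_on X F ->
  continuously_differentiable_on X G ->
  continuously_differentiable_on X (F * G).
Proof.
move=> oX cF cG x Xx; have [dF pF] := cF x Xx; have [dG pG] := cG x Xx.
split=> [|i]; first exact: differentiableM.
apply: (@open_eq_continuous X
  (fun y => F y * partial G i y + G y * partial F i y)) => //.
  move=> y Xy; have [? _] := cF y Xy; have [? _] := cG y Xy.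
  by rewrite /partial deriveM //; exact: diff_derivable.
by apply: continuousD; apply: continuousM => //;
  exact: differentiable_continuous.
Qed.

Lemma cdiffV X F : open X -> (forall x, X x -> F x != 0) ->
  continuously_differentiable_on X F ->
  continuously_differentiable_on X (fun x => (F x)^-1).
Proof.
move=> oX F0 cF x Xx; have [dF pF] := cF x Xx.
split=> [|i]; first by apply: differentiableV => //; exact: F0.
have cFV : {for x, continuous (fun y => (F y)^-1)}.
  by apply: continuousV; [exact: F0 | exact: differentiable_continuous].
apply: (@open_eq_continuous X
  (fun y => - ((F y)^-1 * (F y)^-1) * partial F i y)) => //.
  move=> y Xy; have [? _] := cF y Xy.
  rewrite /partial deriveV //; [|exact: F0|exact: diff_derivable].
  by rewrite -invfM -expr2.
by apply: continuousM => //; apply: continuousN; apply: continuousM.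
Qed.

Lemma cdiff_sum X k (F : 'I_k -> 'cV[R]_n -> R) : open X ->
  (forall i, continuously_differentiable_on X (F i)) ->
  continuously_differentiable_on X (\sum_(i < k) F i).
Proof.
move=> oX cF; elim/big_ind: _ => // [|G H]; first exact: cdiff_cst.
exact: cdiffD.
Qed.

End ContinuouslyDifferentiable.

(** * The first integrals *)

Lemma pairing_trmx (F : fieldType) (n : nat) (A : 'M[F]_n) (u x : 'cV[F]_n) :
  pairing u (A *m x) = pairing (A^T *m u) x.
Proof.
have pE (w y : 'cV[F]_n) : pairing w y = (w^T *m y) 0 0.
  by rewrite mxE; apply: eq_bigr => i _; rewrite mxE.
by rewrite !pE trmx_mul trmxK mulmxA.
Qed.

Lemma solves_psi_systemE (R : realType) (n : nat) (nu : nat -> 'cV[R]_n) m X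
    (Psi : nat -> 'cV[R]_n -> R) :
  solves_psi_system nu m X Psi <->
  forall x, X x -> forall j, (j < m - 1)%N -> pairing (nu j.+1) x =
    binomial_convolution (fun i => Psi i.+1 x) (fun k => pairing (nu k) x) j.
Proof.
have E x j : \sum_(1 <= i < j.+2) 'C(j.+1 - 1, i - 1)%:R * Psi i x *
    pairing (nu (j.+1 - i)%N) x =
    binomial_convolution (fun i => Psi i.+1 x) (fun k => pairing (nu k) x) j.
  rewrite big_add1 big_mkord; apply: eq_bigr => i _.
  by rewrite !subSS !subn0.
split=> H => [x Xx j jm|[|k] // km x Xx]; last by rewrite E H.
by rewrite -E; apply: H.
Qed.

Theorem theorem3p7 (R : realType) (n : nat) (A B : 'M[R]_n) (hB : B = A^T)
  (lambda : R) (m : nat) (hm : (2 <= m)%N)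
  (hdiv : has_elementary_divisor B lambda m)
  (nu : nat -> 'cV[R]_n)
  (hnu0 : is_eigenvector B lambda (nu 0%N))
  (hnu : forall k, (1 <= k <= m - 1)%N ->
     is_generalized_eigenvector B lambda nu k)
  (X : set 'cV[R]_n) (hX : is_domain X)
  (hXnu : X `<=` [set x | pairing (nu 0%N) x != 0]) :
  [/\ exists Psi, solves_psi_system nu m X Psi,
      forall Psi Phi, solves_psi_system nu m X Psi ->
        solves_psi_system nu m X Phi ->
        forall k, (1 <= k <= m - 1)%N -> forall x, X x -> Psi k x = Phi k x
    & forall Psi, solves_psi_system nu m X Psi ->
        forall g, (2 <= g <= m - 1)%N -> is_first_integral A X (Psi g)].
Proof.
have [oX _ _] := hX.
pose p k := pairing (nu k).
split.
- have /choice[q hq] (x : 'cV[R]_n) : exists q : nat -> R, X x ->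
      forall j, (j < m - 1)%N -> p j.+1 x = binomial_convolution q (p ^~ x) j.
    have [Xx|] := pselect (X x); last by exists (fun=> 0).
    have [q hq] := convolution_system_exists (p ^~ x) (m - 1) (hXnu x Xx).
    by exists q.
  by exists (fun i x => q x i.-1); apply/solves_psi_systemE.
- move=> Psi Phi /solves_psi_systemE hPsi /solves_psi_systemE hPhi.
  move=> [|k] // km x Xx.
  exact: (convolution_system_unique (p ^~ x) (fun i => Psi i.+1 x)
    (fun i => Phi i.+1 x) (m - 1) (hXnu x Xx) (hPsi x Xx) (hPhi x Xx)).
move=> Psi /solves_psi_systemE hPsi.
(* Solving the equation of index [j + 1] for [Psi_{j+1}]. *)
have cPsi j : (j < m - 1)%N -> continuously_differentiable_on X (Psi j.+1).
  elim/ltn_ind: j => j IH jm.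
  apply: (@cdiff_eq _ _ X ((p j.+1 - \sum_(i < j)
    (cst 'C(j, i)%:R * Psi i.+1 * p (j - i)%N)) * (fun x => (p 0%N x)^-1))) => //.
    move=> x Xx; rewrite !fctE fct_sumE /p hPsi // binomial_convolution_recr.
    by rewrite [X in X - _]addrC addrK mulfK //; exact: hXnu.
  apply: cdiffM => //; last by apply: cdiffV => //; exact: cdiff_pairing.
  apply: cdiffB => //; first exact: cdiff_pairing.
  apply: cdiff_sum => // i; apply: cdiffM => //; last exact: cdiff_pairing.
  apply: cdiffM => //; first exact: cdiff_cst.
  by apply: IH => //; exact: ltn_trans jm.
move=> [|[|g]] // gm; split=> [|x Xx]; first exact: cPsi.
have dPsi j : (j < m - 1)%N -> differentiable (Psi j.+1) x.
  by move=> jm; have [] := cPsi j jm x Xx.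
rewrite derive_partial; last exact: dPsi.
apply: (log_derivation lambda (p ^~ x) (fun k => 'D_(A *m x) (p k) x)
  (fun i => Psi i.+1 x) (fun i => 'D_(A *m x) (Psi i.+1) x) (m - 1)) => //.
- exact: hXnu.
- (* For [k = 0] the term [k p_{k-1}] is zero and the eigenvector equation
     takes the place of the chain relation. *)
  move=> k km; rewrite derive_pairing pairing_trmx -hB.
  have -> : B *m nu k = lambda *: nu k + k%:R *: nu k.-1.
    case: k km => [|k] km; first by rewrite scale0r addr0; case: hnu0.
    have [_ <-] := hnu k.+1 km.
    by rewrite mulmxBl mul_scalar_mx addrC subrK.
  rewrite /p /pairing !mulr_sumr -big_split; apply: eq_bigr => i _ /=.
  by rewrite !mxE; ring.
- exact: hPsi.
(* The Leibniz rule for the equation of index [j + 1], which holds near [x]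
   because [X] is open. *)
move=> j jm.
have -> : 'D_(A *m x) (p j.+1) x = 'D_(A *m x) (\sum_(i < j.+1)
    (cst 'C(j, i)%:R * Psi i.+1 * p (j - i)%N)) x.
  apply: near_eq_derive.
  have : nbhs x X by exact: open_nbhs_nbhs.
  by apply: filterS => y Xy; rewrite fct_sumE /p hPsi.
have dc (i : 'I_j.+1) : differentiable (cst ('C(j, i)%:R : R) * Psi i.+1) x.
  apply: differentiableM; first exact: differentiable_cst.
  by apply: dPsi; exact: leq_trans (ltn_ord i) jm.
rewrite derive_sum => [|i]; last first.
  apply: diff_derivable; apply: differentiableM => //.
  exact: pairing_differentiable.
rewrite -big_split; apply: eq_bigr => i _ /=.
rewrite deriveM; [|exact: diff_derivable|].
  rewrite deriveM ?derive_cst.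
  - by rewrite !fctE /= /GRing.scale /=; ring.
  - by apply: diff_derivable; exact: differentiable_cst.
  by apply/diff_derivable/dPsi; exact: leq_trans (ltn_ord i) jm.
by apply: diff_derivable; exact: pairing_differentiable.
Qed.
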